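(* For every $\varepsilon>0$ and $\Delta>0$ there exists $c>0$ such that the following holds. Let $G$ be a connected graph on vertex set $[n]$ with maximum degree at most $\Delta$, let $R\sim G(n,\varepsilon/n)$ and $G^*=G\cup R$. Then asymptotically almost surely $G^*$ contains a path of length at least $cn$.
   Context: $G(n,p)$ denotes the binomial random graph on $[n]$ with each pair an edge independently with probability $p$; $G\cup R$ is the graph on $[n]$ with edge set the union of those of $G$ and $R$. Asymptotically almost surely means with probability tending to $1$ as $n\to\infty$, for an arbitrary sequence of such graphs $G=G_n$. *)

(* Defs.v *)
From mathcomp Require Import all_boot.
From Stdlib Require Import Reals ClassicalDescription.

Set Implicit Arguments.
Unset Strict Implicit.
Unset Printing Implicit Defensive.

Definition simple_graph (n : nat) (G : rel 'I_n) : Prop :=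
  symmetric G /\ irreflexive G.

Definition connected_graph (n : nat) (G : rel 'I_n) : Prop :=
  forall x y : 'I_n, connect G x y.

Definition degree (n : nat) (G : rel 'I_n) (x : 'I_n) : nat :=
  #|[set y | G x y]|.

Definition max_degree_le (n : nat) (G : rel 'I_n) (D : R) : Prop :=
  forall x : 'I_n, (INR (degree G x) <= D)%R.

(* Possible edges {i,j}, i<j, encoded as ordered pairs (i,j) with i < j. *)
Definition pairs (n : nat) : {set 'I_n * 'I_n} :=
  [set ij | (val ij.1 < val ij.2)%N].

Definition gnp_weight (n : nat) (p : R) (S : {set 'I_n * 'I_n}) : R :=
  if S \subset pairs n
  then (p ^ #|S| * (1 - p) ^ (#|pairs n| - #|S|))%R
  else 0%R.

Definition gnp_prob (n : nat) (p : R) (E : {set 'I_n * 'I_n} -> Prop) : R :=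
  \big[Rplus/0%R]_(S : {set 'I_n * 'I_n})
     (if excluded_middle_informative (E S) then gnp_weight p S else 0%R).

Definition union_graph (n : nat) (G : rel 'I_n) (S : {set 'I_n * 'I_n}) : rel 'I_n :=
  fun x y => [|| G x y, (x, y) \in S | (y, x) \in S].

Definition has_path_of_length_ge (n : nat) (H : rel 'I_n) (L : R) : Prop :=
  exists (x : 'I_n) (p : seq 'I_n),
    uniq (x :: p) /\ path H x p /\ (L <= INR (size p))%R.

(* Main.v *)
Require Import Defs.
From mathcomp Require Import all_boot all_order all_algebra.
From mathcomp Require Import zify.
From Stdlib Require Import Reals ClassicalDescription Lra.
From mathcomp Require Import Rstruct.

(** Peel off [G] disjoint connected pieces of between [k] and [D k] vertices,
    [k] a large constant: there are [m], of order [n / (D k)], of them.  If every two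
    disjoint families of [t = m / 4] pieces are joined by an edge of [R], then
    depth-first search on the pieces finds a path through at least [m / 2] of
    them, and it lifts to [G^*] because each piece is connected in [G].  Two
    given families are not joined with probability at most
    [(1 - eps / n) ^ (t k)^2], i.e. [exp (- c0 n)] with [c0] independent of
    [k], which beats the at most [4 ^ m <= 4 ^ (n / k)] pairs of families. *)

Set Implicit Arguments.
Unset Strict Implicit.
Unset Printing Implicit Defensive.
Import ssrnat Order.TTheory GRing.Theory Num.Theory.

(** * Connected pieces *)

Lemma leq_card_bigcup (I T : finType) (P : pred I) (F : I -> {set T}) :
  #|\bigcup_(i | P i) F i| <= \sum_(i | P i) #|F i|.
Proof.
elim/big_rec2: _ => [|i m A _ leAm]; first by rewrite cards0.
by apply: leq_trans (leq_of_leqif (leq_card_setU _ _)) _; rewrite leq_add2l.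
Qed.

Section InducedConnectivity.
Variables (T : finType) (G : rel T).
Implicit Types (A B C U : {set T}) (x y v w : T).

Definition induced A : rel T := fun x y => [&& x \in A, y \in A & G x y].

Definition connected_set A : Prop :=
  {in A &, forall x y, connect (induced A) x y}.

Lemma connect_inducedS A B x y :
  A \subset B -> connect (induced A) x y -> connect (induced B) x y.
Proof.
move=> /subsetP sAB; apply: connect_sub => a b /and3P[Aa Ab Gab].
by apply: connect1; rewrite /induced !sAB.
Qed.

(** A walk in [B] that starts in the closed set [A] never leaves it, so all its steps survive in
    [induced A]. Applied to a component of [B], this makes the component connected within itself. *)
Lemma connect_induced_closed A B x y :
    (forall a b, a \in A -> induced B a b -> b \in A) ->
  x \in A -> connect (induced B) x y -> (y \in A) && connect (induced A) x y.
Proof.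
move=> clA Ax /connectP[p pp ->] {y}.
elim: p x Ax pp => [|z p IHp] x Ax /=; first by rewrite Ax connect0.
case/andP=> Bxz /IHp; have Az := clA _ _ Ax Bxz.
case/(_ Az)/andP=> -> /=; apply: connect_trans; apply: connect1.
by case/and3P: Bxz => _ _ Gxz; apply/and3P.
Qed.

Hypothesis symG : symmetric G.

Lemma connect_induced_sym A : connect_sym (induced A).
Proof.
by apply: sym_connect_sym => x y; rewrite /induced symG andbCA andbA.
Qed.

Lemma connected_set_root A v :
    (forall x, x \in A -> connect (induced A) v x) -> connected_set A.
Proof.
move=> vA x y Ax Ay; apply: connect_trans (vA y Ay).
by rewrite connect_induced_sym vA.
Qed.

Definition component B w := [set y | connect (induced B) w y].

Lemma component_closed B w a b :
  a \in component B w -> induced B a b -> b \in component B w.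
Proof.
by rewrite !inE => wa Bab; apply: connect_trans wa (connect1 Bab).
Qed.

Lemma component_sub B w : w \in B -> component B w \subset B.
Proof.
move=> Bw; apply/subsetP=> y; rewrite inE.
have cl a b : a \in B -> induced B a b -> b \in B by move=> _ /and3P[].
by case/(connect_induced_closed cl Bw)/andP.
Qed.

Lemma mem_component B w : w \in component B w.
Proof. by rewrite inE connect0. Qed.

Lemma component_connected B w : connected_set (component B w).
Proof.
apply: (@connected_set_root _ w) => x; rewrite inE => wx.
by have /andP[] := connect_induced_closed (@component_closed B w)
                                          (mem_component B w) wx.
Qed.

(** On a simple path from [v] to [x] the second vertex serves as [w]: since [v] does not recur, the
    rest of the path stays in [A :\ v]. *)
Lemma connected_set_delete A v x :
    connected_set A -> v \in A -> x \in A :\ v ->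
  exists2 w, (w \in A :\ v) && G v w & x \in component (A :\ v) w.
Proof.
move=> cA Av /setD1P[nxv Ax].
have /connectP[p0 pp0 def_x] := cA v x Av Ax.
case: (shortenP pp0) def_x => [[|w p] pp Up _ def_x].
  by rewrite def_x eqxx in nxv.
move: pp Up => /= /andP[/and3P[_ Aw Gvw] pp] /and3P[vp _ _].
move: vp; rewrite in_cons eq_sym => /norP[nvw vp].
have Avw : w \in A :\ v by rewrite !inE nvw.
exists w; first by rewrite Avw.
rewrite inE; apply/connectP; exists p => //.
elim: p w pp vp Avw {def_x Gvw Aw nvw} => //= z p IHp w.
case/andP=> [/and3P[_ Az Gwz] pp] vzp Avw.
move: vzp; rewrite in_cons => /norP[nvz vp].
have Avz : z \in A :\ v by rewrite !inE eq_sym nvz Az.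
by rewrite {1}/induced Avw Avz Gwz /=; apply: IHp.
Qed.

(* A smallest connected [A] of size at least [k] with connected complement:
   deleting its attachment vertex [v] leaves at most [D] components, each of
   which is again such a set unless it has fewer than [k] vertices. *)
Lemma connected_set_peel D k U :
    (forall x, #|[set y | G x y]| <= D) -> 0 < D -> 0 < k ->
    connected_set U -> k <= #|U| ->
  exists A, [/\ A \subset U, connected_set A, connected_set (U :\: A),
                k <= #|A| & #|A| <= D * k].
Proof.
move=> degG D_gt0 k_gt0 cU leU.
set goal := ex _.
(* The vertex [v] attaches [A] to the rest: the complement stays connected with or without [v]. The
   search starts from [A = U] with any [v], where the complement is empty. *)
suff peel m : forall A v, #|A| <= m -> v \in A -> A \subset U ->
    connected_set A -> connected_set (U :\: A) -> connected_set (v |: (U :\: A)) ->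
    k <= #|A| -> goal.
  have [v Uv] : exists v, v \in U.
    by apply/set0Pn; rewrite -card_gt0; apply: leq_trans leU.
  apply: (peel _ _ _ (leqnn #|U|) Uv) => //.
    by rewrite setDv => x y; rewrite inE.
  rewrite setDv setU0 => x y; rewrite !inE => /eqP-> /eqP->; exact: connect0.
elim: m => [|m IHm] A v leAm Av sAU cA cUA cvUA lekA.
  by rewrite leqn0 cards_eq0 in leAm; rewrite (eqP leAm) inE in Av.
pose C w := component (A :\ v) w.
have [w /and3P[Avw Gvw lekC] | smallC] :=
    @pickP _ (fun w => [&& w \in A :\ v, G v w & k <= #|C w|]).
- have sCA : C w \subset A :\ v by apply: component_sub.
  have sCU : C w \subset U.
    by apply: subset_trans sCA (subset_trans (subD1set _ _) sAU).
  have Uv : v \in U :\: C w.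
    rewrite inE (subsetP sAU) // andbT.
    by apply/negP=> /(subsetP sCA); rewrite !inE eqxx.
  (* Removing a large component [C w] leaves everything attached to [v]: vertices outside [A] by the
     invariant, those of [A :\ v] through their own component, which avoids [C w] and contains a
     neighbour of [v]. *)
  have rootv x : x \in U :\: C w -> connect (induced (U :\: C w)) v x.
    have [Ax | nAx] := boolP (x \in A); last first.
      case/setDP=> Ux _; have Uvx : x \in v |: (U :\: A) by rewrite !inE nAx Ux orbT.
      apply: connect_inducedS (cvUA _ _ (setU11 _ _) Uvx).
      rewrite subUset sub1set Uv setDS //.
      by apply: subset_trans sCA (subD1set _ _).
    case: (eqVneq x v) => [-> | nxv]; first by rewrite connect0.
    have Avx : x \in A :\ v by rewrite !inE nxv.
    case/setDP=> Ux nCx.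
    have [z /andP[Avz Gvz] Czx] := connected_set_delete cA Av Avx.
    have sCzU : C z \subset U :\: C w.
      apply/subsetP=> y Czy; rewrite inE; apply/andP; split.
        apply: contra nCx; move: Czx Czy; rewrite !inE => zx zy wy.
        apply: connect_trans wy (connect_trans _ zx).
        by rewrite connect_induced_sym.
      apply: (subsetP sAU); apply: (subsetP (subD1set A v)).
      exact: (subsetP (component_sub Avz)).
    apply: connect_trans (connect_inducedS sCzU _).
      apply: connect1; apply/and3P; split; first exact: Uv.
        exact: (subsetP sCzU) (mem_component _ _).
      exact: Gvz.
    exact: component_connected (mem_component _ _) Czx.
  apply: (IHm (C w) w) => //.
  + rewrite -ltnS; apply: leq_trans leAm.
    by apply: leq_ltn_trans (subset_leq_card sCA) _; rewrite (cardsD1 v A) Av.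
  + exact: mem_component.
  + exact: component_connected.
  + exact: connected_set_root rootv.
  apply: (@connected_set_root _ v) => x; case/setU1P=> [->|Ux].
    apply: connect1; apply/and3P; split; last exact: Gvw.
      exact: setU1r Uv.
    exact: setU11.
  exact: connect_inducedS (subsetUr _ _) (rootv x Ux).
(* Now all components at neighbours of [v] have at most [k.-1] vertices, so [A] has at most
   [1 + D * k.-1], which is at most [D * k] because [D] is positive. *)
exists A; split=> //.
have sAC : A :\ v \subset \bigcup_(w in [set y in A :\ v | G v y]) C w.
  apply/subsetP=> x Ax; have [w wP Cwx] := connected_set_delete cA Av Ax.
  by apply/bigcupP; exists w => //; rewrite inE.
rewrite (cardsD1 v A) Av.
suff: #|A :\ v| <= D * k.-1 by case: (k) k_gt0 (D) D_gt0 => // a _ [] // b _; nia.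
apply: leq_trans (subset_leq_card sAC) _.
apply: leq_trans (leq_card_bigcup _ _) _.
apply: (@leq_trans (\sum_(w in [set y in A :\ v | G v y]) k.-1)).
  apply: leq_sum => w; rewrite inE => /andP[Aw Gvw].
  by have := smallC w; rewrite /= Aw Gvw /= => /negbT; rewrite -ltnNge; lia.
rewrite sum_nat_const leq_mul2r; apply/orP; right.
apply: leq_trans (degG v); apply: subset_leq_card.
by apply/subsetP=> y; rewrite !inE => /andP[].
Qed.

(** Peeling is repeated on the connected remainder. Each round costs at most [D * k] vertices, and
    the final [+ k] pays for the remainder too small to peel. *)
Lemma connected_pieces D k U :
    (forall x, #|[set y | G x y]| <= D) -> 0 < D -> 0 < k -> connected_set U ->
  exists P : {set {set T}},
    [/\ trivIset P, {in P, forall A, [/\ A \subset U, connected_set A & k <= #|A|]}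
      & #|U| <= D * k * #|P| + k].
Proof.
move=> degG D_gt0 k_gt0; have [m] := ubnP #|U|.
elim: m U => // m IHm U ltUm cU.
have [ltUk | lekU] := ltnP #|U| k.
  exists set0; split; first by apply/trivIsetP=> A; rewrite inE.
    by move=> A; rewrite inE.
  by apply: leq_trans (ltnW ltUk) (leq_addl _ _).
have [A [sAU cA cUA lekA leA]] := connected_set_peel degG D_gt0 k_gt0 cU lekU.
have cardUA : #|U :\: A| = #|U| - #|A| by rewrite cardsD (setIidPr sAU).
have [|P [tP pP leP]] := IHm (U :\: A) _ cUA; first by rewrite cardUA; lia.
have disA : {in P, forall B, [disjoint A & B]}.
  move=> B /pP[sB _ _]; rewrite disjoint_sym; apply: disjointWl sB _.
  by rewrite -setI_eq0 setDE -setIA (setIC (~: A)) setICr setI0.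
have nP0 : set0 \notin P by apply/negP=> /pP[_ _]; rewrite cards0; lia.
have [tAP nAP] := trivIsetU1 disA tP nP0.
exists (A |: P); split=> //.
  move=> B /setU1P[-> // | /pP[sB cB leB]]; split=> //.
  exact: subset_trans sB (subsetDl _ _).
by rewrite cardsU1 nAP; have := subset_leq_card sAU; nia.
Qed.

End InducedConnectivity.

(** * Depth-first search *)

(* Depth-first search from the empty stack, stopped when the set [A] of
   finished vertices and the set [B] of unvisited ones have the same size:
   no edge joins [A] to [B], and all other vertices lie on the stack [s]. *)
Lemma dfs_balanced (T : finType) (E : rel T) (P : {set T}) :
    symmetric E ->
  exists (A B : {set T}) (s : seq T),
    [/\ [/\ A \subset P, B \subset P & [disjoint A & B]], #|A| = #|B|,
        {in A & B, forall a b, ~~ E a b},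
        [/\ uniq s, sorted E s & {subset s <= P}]
      & #|A| + #|B| + size s = #|P|].
Proof.
move=> symE; set goal := ex _.
(* A push lowers [2 * #|B| + size s] by one, and so does a pop. Either move also lowers
   [#|B| - #|A|] by exactly one, so equality cannot be skipped. *)
suff search m : forall (A B : {set T}) (s : seq T),
    2 * #|B| + size s < m -> #|A| <= #|B| ->
    [/\ A \subset P, B \subset P & [disjoint A & B]] ->
    {in A & B, forall a b, ~~ E a b} ->
    uniq s -> sorted E s ->
    {in s, forall x, [/\ x \in P, x \notin A & x \notin B]} ->
    #|A| + #|B| + size s = #|P| -> goal.
  apply: (search _ set0 P [::] (ltnSn _)); rewrite ?cards0 ?addn0 //.
    by rewrite sub0set -setI_eq0 set0I.
  by move=> a b; rewrite inE.
elim: m => // m IHm A B s ltm leAB [sAP sBP dAB] nE Us Es sP cardP.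
have [ltAB | leBA] := ltnP #|A| #|B|; last first.
  exists A, B, s; split=> //; first by apply/eqP; rewrite eqn_leq leAB.
  by split=> // x /sP[].
have push y : y \in B -> sorted E (y :: s) -> goal.
  move=> By Eys; have cardB := cardsD1 y B; rewrite By in cardB.
  have nAy : y \notin A by rewrite (disjointFl dAB).
  apply: (IHm A (B :\ y) (y :: s)) => //=; try lia.
  - split=> //; first exact: subset_trans (subD1set _ _) sBP.
    exact: disjointWr (subD1set _ _) dAB.
  - by move=> a b Aa /setD1P[_ Bb]; apply: nE.
  - by rewrite Us andbT; apply/negP=> /sP[_ _]; rewrite By.
  move=> z; rewrite in_cons => /predU1P[-> | /sP[Pz nAz nBz]].
    by rewrite (subsetP sBP) // nAy !inE eqxx.
  by split; rewrite // inE negb_and nBz orbT.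
case: s => [|x s] in ltm Us Es sP cardP push *.
  have [y By] : exists y, y \in B by apply/set0Pn; rewrite -card_gt0; lia.
  exact: push By _.
(* If the top [x] has an unvisited neighbour, it is pushed; otherwise [x] has no edge to [B] and may
   join [A]. *)
have [y /andP[By Exy] | nExB] := @pickP _ (fun y => (y \in B) && E x y).
  by apply: (push y By) => /=; rewrite symE Exy.
have [Px nAx nBx] := sP x (mem_head x s).
have cardAx : #|x |: A| = #|A|.+1 by rewrite cardsU1 nAx.
have /andP[nsx Us'] := Us.
apply: (IHm (x |: A) B s) => //=.
- by move: ltm => /=; lia.
- by rewrite cardAx.
- split=> //; first by rewrite subUset sub1set Px.
  by rewrite -setI_eq0 setIUl setU_eq0 !setI_eq0 dAB disjoints1 nBx.
- move=> a b /setU1P[-> | Aa] Bb; last exact: nE.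
  by have := nExB b; rewrite Bb /= => ->.
- exact: path_sorted Es.
- move=> z sz; have [|Pz nAz nBz] := sP z; first by rewrite in_cons sz orbT.
  split=> //; rewrite !inE negb_or nAz andbT.
  by apply: contraNneq nsx => <-.
by move: cardP => /=; lia.
Qed.

(** The balanced sets of the search have no edge between them, so each has fewer than [t] elements;
    the stack holds all the others. *)
Lemma long_path_of_joined (T : finType) (E : rel T) (P : {set T}) (t : nat) :
    symmetric E ->
    (forall A B : {set T}, A \subset P -> B \subset P -> [disjoint A & B] ->
       t <= #|A| -> t <= #|B| -> exists a b, [/\ a \in A, b \in B & E a b]) ->
  exists s : seq T, [/\ uniq s, sorted E s, {subset s <= P} & #|P| < size s + 2 * t].
Proof.
move=> symE joinE.
have [A [B [s [[sAP sBP dAB] eqAB nE [Us Es sP] cardP]]]] := dfs_balanced P symE.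
exists s; split=> //; have [ltA | leA] := ltnP #|A| t; first by rewrite -cardP -eqAB; lia.
have [|a [b [Aa Bb]]] := joinE A B sAP sBP dAB leA; first by rewrite -eqAB.
by rewrite (negPf (nE a b Aa Bb)).
Qed.

(** * Lifting a path of pieces to a path of vertices *)

Definition joined (T : finType) (H : rel T) : rel {set T} :=
  fun A B => [exists a in A, exists b in B, H a b].

Lemma joinedP (T : finType) (H : rel T) (A B : {set T}) :
  reflect (exists a b, [/\ a \in A, b \in B & H a b]) (joined H A B).
Proof.
apply: (iffP exists_inP) => [[a Aa /exists_inP[b Bb Hab]] | [a [b [Aa Bb Hab]]]].
  by exists a, b.
by exists a => //; apply/exists_inP; exists b.
Qed.

(** The entry vertex [x] is arbitrary because the preceding edge dictates it: inside [A] a simple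
    [G]-path leads from [x] to the exit [a], then [H] crosses to [b] in the next piece. The last
    conclusion lets the induction derive uniqueness from the disjointness of the pieces. *)
Lemma path_through_pieces (T : finType) (G H : rel T) (P : {set {set T}})
    (A : {set T}) (s : seq {set T}) (x : T) :
    subrel G H -> trivIset P -> {in P, forall B, connected_set G B} ->
    x \in A -> uniq (A :: s) -> path (joined H) A s -> {subset A :: s <= P} ->
  exists p, [/\ uniq (x :: p), path H x p, size s <= size p
    & {in x :: p, forall y, exists2 B, B \in A :: s & y \in B}].
Proof.
move=> sGH /trivIsetP tP cP; elim: s A x => [|B s IHs] A x Ax.
  move=> _ _ _; exists [::]; split=> // y; rewrite inE => /eqP->.
  by exists A; rewrite ?mem_head.
rewrite cons_uniq => /andP[nsA UBs] /= /andP[/joinedP[a [b [Aa Bb Hab]]] pBs] sP.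
have sBP : {subset B :: s <= P} by move=> C sC; apply: sP; rewrite in_cons sC orbT.
have [p [Up Hp lep pB]] := IHs B b Bb UBs pBs sBP.
have PA := sP A (mem_head _ _).
have /connectP[q0 pq0 def_a] := cP A PA x a Ax Aa.
case: (shortenP pq0) def_a => q pq Uq _ def_a.
have qA : {in x :: q, forall y, y \in A}.
  move=> y; rewrite in_cons => /predU1P[-> // | qy]; move: qy.
  elim: (q) x pq {Ax pq0 Uq def_a} => //= z r IHr x /andP[/and3P[_ Az _] pr].
  by rewrite in_cons => /predU1P[-> | ry] //; apply: IHr pr ry.
exists (q ++ b :: p); split.
- rewrite -cons_uniq -cat_cons cat_uniq Uq Up andbT andTb; apply/hasPn=> y /pB[C sC Cy].
  apply/negP=> xqy; have Ay := qA y xqy; have nAC : A != C by apply: contraNneq nsA => ->.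
  by have /disjointFr/(_ Ay) := tP A C PA (sBP C sC) nAC; rewrite Cy.
- rewrite cat_path /= -def_a Hab Hp !andbT.
  by apply: (sub_path _ pq) => u v /and3P[_ _ /sGH].
- by rewrite size_cat /=; lia.
move=> y; rewrite -[x :: _]/((x :: q) ++ _) mem_cat => /orP[xqy | /pB[C sC Cy]].
  by exists A; [rewrite mem_head | apply: qA].
by exists C; rewrite // in_cons sC orbT.
Qed.

(** * The binomial random graph *)

Section BinomialRandomSet.
Local Open Scope ring_scope.

Lemma sum_subset_binomial (R : comNzRingType) (T : finType) (Q : {set T}) (a b : R) :
  \sum_(S : {set T} | S \subset Q) a ^+ #|S| * b ^+ (#|Q| - #|S|) = (a + b) ^+ #|Q|.
Proof.
rewrite -[RHS]prodr_const [RHS]big_mkcond /=.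
(* Outside [Q] the factor is [0 + 1], so expanding the product over the whole type kills every [S]
   that is not inside [Q]. *)
transitivity (\prod_i ((if i \in Q then a else 0) + (if i \in Q then b else 1))).
  rewrite bigA_distr big_mkcond /=; apply: eq_bigr => S _.
  have [sSQ | /subsetPn[x Sx nQx]] := boolP (S \subset Q); last first.
    by rewrite (bigD1 x) //= Sx (negPf nQx) mul0r.
  rewrite (bigID (mem S)) /=; congr (_ * _).
    rewrite -prodr_const; apply: eq_bigr => i Si.
    by rewrite Si (subsetP sSQ).
  have <- : #|Q :\: S| = (#|Q| - #|S|)%nat by rewrite cardsD (setIidPr sSQ).
  rewrite -prodr_const big_mkcond [RHS]big_mkcond /=; apply: eq_bigr => i _.
  rewrite !inE.
  by case: (i \in S).
by apply: eq_bigr => i _; case: ifP => // _; rewrite add0r.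
Qed.

Variables (n : nat) (p : R).
Hypothesis p01 : (0 <= p <= 1)%R.
Implicit Types (S F : {set 'I_n * 'I_n}).

Let p_ge0 : 0 <= p.
Proof. by apply/RleP; case: p01. Qed.

Let q_ge0 : 0 <= 1 - p.
Proof. by rewrite subr_ge0; apply/RleP; case: p01. Qed.

Lemma gnp_weightE S :
  gnp_weight p S =
    if S \subset pairs n then p ^+ #|S| * (1 - p) ^+ (#|pairs n| - #|S|) else 0.
Proof. by rewrite /gnp_weight !RpowE. Qed.

Lemma gnp_weight_ge0 S : 0 <= gnp_weight p S.
Proof.
rewrite gnp_weightE; case: ifP => // _.
by rewrite mulr_ge0 // exprn_ge0.
Qed.

(** A set avoiding [F] is a choice among the remaining pairs. Once [(1 - p) ^+ #|F|] is factored
    out, the weights sum to [(p + (1 - p))] to a power, which is 1. *)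
Lemma gnp_weight_avoid F : F \subset pairs n ->
  \sum_(S : {set 'I_n * 'I_n} | [disjoint S & F]) gnp_weight p S = (1 - p) ^+ #|F|.
Proof.
move=> sF; have cardF : #|pairs n :\: F| = (#|pairs n| - #|F|)%nat.
  by rewrite cardsD (setIidPr sF).
have leF := subset_leq_card sF.
transitivity (\sum_(S : {set 'I_n * 'I_n} | S \subset pairs n :\: F)
    (1 - p) ^+ #|F| * (p ^+ #|S| * (1 - p) ^+ (#|pairs n :\: F| - #|S|))).
  rewrite big_mkcond [RHS]big_mkcond /=; apply: eq_bigr => S _.
  rewrite gnp_weightE subsetD; case dS: [disjoint S & F]; rewrite ?andbF // andbT.
  case: ifP => // sS.
  rewrite mulrCA -exprD; congr (_ * _ ^+ _).
  have : (#|S| <= #|pairs n :\: F|)%nat by rewrite subset_leq_card // subsetD sS dS.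
  by rewrite cardF => leS; rewrite addnBA // subnKC.
by rewrite -mulr_sumr sum_subset_binomial subrKC expr1n mulr1.
Qed.

Lemma gnp_probE (E : {set 'I_n * 'I_n} -> Prop) :
  gnp_prob p E =
    \sum_(S : {set 'I_n * 'I_n} | excluded_middle_informative (E S)) gnp_weight p S.
Proof.
rewrite /gnp_prob [RHS]big_mkcond /=; apply: eq_bigr => S _.
by case: excluded_middle_informative.
Qed.

Lemma gnp_prob_union_bound (I : finType) (Q : pred I) (F : I -> {set 'I_n * 'I_n}) m
    (E : {set 'I_n * 'I_n} -> Prop) :
    (forall i, Q i -> F i \subset pairs n /\ (m <= #|F i|)%nat) ->
    (forall S, (forall i, Q i -> ~~ [disjoint S & F i]) -> E S) ->
  (1 - INR #|Q| * (1 - p) ^ m <= gnp_prob p E)%R.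
Proof.
move=> FP EP; apply/RleP; rewrite !RminusE R1E RmultE RpowE INRE mulr_natl gnp_probE.
(* The total mass is the case of avoiding the empty set. *)
have w1 : \sum_(S : {set 'I_n * 'I_n}) gnp_weight p S = 1.
  have := gnp_weight_avoid (sub0set (pairs n)); rewrite cards0 expr0 => <-.
  by apply: eq_bigl => S; rewrite -setI_eq0 setI0 eqxx.
rewrite -{1}w1 (bigID (fun S => is_left (excluded_middle_informative (E S)))) /=.
rewrite lerBlDr lerD2l.
have -> : (1 - p) ^+ m *+ #|Q| = \sum_(i | Q i) (1 - p) ^+ m by rewrite sumr_const.
apply: (@le_trans _ _ (\sum_(i | Q i)
    \sum_(S : {set 'I_n * 'I_n} | [disjoint S & F i]) gnp_weight p S)).
  (* After the exchange of sums, each [S] violating [E] misses some [F i], so its weight is counted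
     at least once. *)
  rewrite (exchange_big_dep predT) //= big_mkcond /=; apply: ler_sum => S _.
  case: excluded_middle_informative => /= [ES | nES].
    by apply: sumr_ge0 => i _; apply: gnp_weight_ge0.
  have [i /andP[Qi dSi] | noi] := @pickP _ (fun i => Q i && [disjoint S & F i]).
    rewrite (bigD1 i) /= ?Qi // lerDl.
    by apply: sumr_ge0 => j _; apply: gnp_weight_ge0.
  by case: nES; apply: EP => i Qi; have /= := noi i; rewrite Qi /= => ->.
apply: ler_sum => i /FP[sF lem]; rewrite gnp_weight_avoid //.
by apply: ler_wiXn2l; rewrite // lerBlDr lerDl.
Qed.

End BinomialRandomSet.

(** * Pairs between two families of pieces *)

Definition crossing_pairs (n : nat) (X Y : {set 'I_n}) : {set 'I_n * 'I_n} :=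
  [set ij in pairs n | (ij \in setX X Y) || (ij \in setX Y X)].

Lemma card_crossing_pairs (n : nat) (X Y : {set 'I_n}) :
  [disjoint X & Y] -> (#|X| * #|Y| <= #|crossing_pairs X Y|)%nat.
Proof.
move=> dXY; rewrite -cardsX.
(* Sorting is injective on [setX X Y]: two pairs with the same image but opposite orders would put a
   vertex in both [X] and [Y]. *)
pose f (xy : 'I_n * 'I_n) := if (xy.1 < xy.2)%nat then xy else (xy.2, xy.1).
have nXY x : x \in X -> x \in Y -> false by move=> Xx; rewrite (disjointFr dXY).
rewrite -(@card_in_imset _ _ f); last first.
  move=> [x y] [x' y'] /setXP[/= Xx Yy] /setXP[/= Xx' Yy']; rewrite /f /=.
  case: ifP => _; case: ifP => _ //.
    by case=> eq1 _; rewrite -eq1 in Yy'; have := nXY x Xx Yy'.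
    by case=> eq1 _; rewrite -eq1 in Xx'; have := nXY y Xx' Yy.
  by case=> -> ->.
apply/subset_leq_card/subsetP=> _ /imsetP[[x y] /setXP[/= Xx Yy] ->].
have nxy : x != y by apply: contraTneq Xx => ->; apply/negP=> /nXY/(_ Yy).
rewrite /f /=; case: ltnP => [ltxy | leyx]; rewrite !inE /= ?Xx ?Yy ?orbT ?andbT //.
by rewrite ltn_neqAle leyx andbT eq_sym.
Qed.

Lemma card_cover_ge (T : finType) (A : {set {set T}}) (k t : nat) :
    trivIset A -> {in A, forall B : {set T}, (k <= #|B|)%nat} -> (t <= #|A|)%nat ->
  (t * k <= #|cover A|)%nat.
Proof.
move=> /eqP <- kA leA; apply: (@leq_trans (\sum_(B in A) k)%nat).
  by rewrite sum_nat_const leq_mul2r leA orbT.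
exact: leq_sum.
Qed.

Lemma disjoint_cover (T : finType) (P A B : {set {set T}}) :
    trivIset P -> A \subset P -> B \subset P -> [disjoint A & B] ->
  [disjoint cover A & cover B].
Proof.
move=> /trivIsetP tP /subsetP sAP /subsetP sBP dAB.
rewrite -setI_eq0; apply/eqP/setP=> x; rewrite !inE; apply/negP.
case/andP=> /bigcupP[C AC Cx] /bigcupP[D BD Dx].
have nCD : C != D by apply: contraTneq AC => ->; rewrite (disjointFl dAB).
by have /disjointFr/(_ Cx) := tP C D (sAP C AC) (sBP D BD) nCD; rewrite Dx.
Qed.

Lemma sub_crossing_pairs (n : nat) (X Y : {set 'I_n}) :
  crossing_pairs X Y \subset pairs n.
Proof. by apply/subsetP=> ij; rewrite inE => /andP[]. Qed.

Lemma gnp_prob_long_path (n : nat) (G : rel 'I_n) (P : {set {set 'I_n}})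
    (k t : nat) (p L : R) :
    symmetric G -> trivIset P ->
    {in P, forall A : {set 'I_n}, connected_set G A /\ (k <= #|A|)%nat} ->
    (0 < k)%nat -> (2 * t <= #|P|)%nat -> (L + INR (2 * t) <= INR #|P|)%R ->
    (0 <= p <= 1)%R ->
  (1 - INR (4 ^ #|P|) * (1 - p) ^ (t * k * (t * k)) <=
     gnp_prob p (fun S => has_path_of_length_ge (union_graph G S) L))%R.
Proof.
move=> symG tP PP k_gt0 let_P leL p01.
(* The union bound runs over pairs of disjoint large families; the bad event for a pair is that [S]
   misses all crossing pairs of their covers. *)
pose Q := [pred AB : {set {set 'I_n}} * {set {set 'I_n}} |
  [&& AB.1 \subset P, AB.2 \subset P, [disjoint AB.1 & AB.2],
      (t <= #|AB.1|)%nat & (t <= #|AB.2|)%nat]].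
have cardQ : (#|Q| <= 4 ^ #|P|)%nat.
  have -> : (4 ^ #|P| = #|setX (powerset P) (powerset P)|)%nat.
    by rewrite cardsX card_powerset -expnMn.
  apply/subset_leq_card/subsetP=> -[A B]; rewrite !inE /=.
  by case/and5P=> -> ->.
have leF AB : Q AB -> crossing_pairs (cover AB.1) (cover AB.2) \subset pairs n /\
    (t * k * (t * k) <= #|crossing_pairs (cover AB.1) (cover AB.2)|)%nat.
  case: AB => A B /and5P[/= sAP sBP dAB leA leB].
  split; first exact: sub_crossing_pairs.
  apply: leq_trans (card_crossing_pairs (disjoint_cover tP sAP sBP dAB)).
  by apply: leq_mul; apply: card_cover_ge => //;
    [exact: trivIsetS tP | move=> C /(subsetP sAP)/PP[]
    |exact: trivIsetS tP | move=> C /(subsetP sBP)/PP[]].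
apply: (Rle_trans _ (1 - INR #|Q| * (1 - p) ^ (t * k * (t * k)))%R).
  have q_ge0 : (0 <= (1 - p) ^ (t * k * (t * k)))%R by apply: pow_le; lra.
  have : (INR #|Q| <= INR (4 ^ #|P|))%R by apply: le_INR; apply/ssrnat.leP.
  nra.
apply: gnp_prob_union_bound leF _ => // S hitS.
pose H := union_graph G S.
have symH : symmetric H.
  by move=> x y; rewrite /H /union_graph symG [in RHS]orbCA orbA orbC orbA.
have symJ : symmetric (joined H).
  by move=> A B; apply/joinedP/joinedP=> -[a [b [Aa Bb]]];
    rewrite symH; exists b, a.
have joinP (A B : {set {set 'I_n}}) : A \subset P -> B \subset P ->
    [disjoint A & B] -> (t <= #|A|)%nat -> (t <= #|B|)%nat ->
    exists a b, [/\ a \in A, b \in B & joined H a b].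
  move=> sAP sBP dAB leA leB.
  have /pred0Pn[[i j] /= /andP[Sij]] :
      ~~ [disjoint S & crossing_pairs (cover A) (cover B)].
    by apply: (hitS (A, B)); apply/and5P.
  rewrite !inE /= => /andP[_ /orP[] /andP[/bigcupP[C C1 iC] /bigcupP[D D1 jD]]].
    exists C, D; split=> //; apply/joinedP; exists i, j; split=> //.
    by rewrite /H /union_graph Sij orbT.
  exists D, C; split=> //; apply/joinedP; exists j, i; split=> //.
  by rewrite /H /union_graph Sij !orbT.
(* The path of pieces is nonempty because [2 * t <= #|P|]. *)
have [[|A s] [Us Es sP lts]] := long_path_of_joined symJ joinP.
  by move: lts; rewrite /= add0n ltnNge let_P.
have [x Ax] : exists x, x \in A.
  apply/set0Pn; rewrite -card_gt0; apply: leq_trans k_gt0 _.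
  by case: (PP A (sP A (mem_head _ _))).
have sGH : subrel G H by move=> u v Guv; rewrite /H /union_graph Guv.
have cP : {in P, forall B, connected_set G B} by move=> B /PP[].
have [q [Uq Hq lesq _]] := path_through_pieces sGH tP cP Ax Us Es sP.
exists x, q; do 2!split=> //.
(* Length counts edges, one fewer than the pieces in [A :: s]; the strict inequality [lts] absorbs
   this loss. *)
have leq2t : (#|P| <= size q + 2 * t)%nat.
  by move: lts; rewrite /= addSn ltnS => /leq_trans; apply; rewrite leq_add2r.
apply: (Rplus_le_reg_r (INR (2 * t))); apply: Rle_trans leL _.
by rewrite -plus_INR; apply: le_INR; apply/ssrnat.leP.
Qed.

(** * Numerical estimates *)

Lemma Rdiv_unit_interval (a b : R) :
  (0 < a)%R -> (a <= b)%R -> (0 <= a / b <= 1)%R.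
Proof.
move=> a0 leab; split; first by apply: Rlt_le; apply: Rdiv_lt_0_compat; lra.
by apply: (Rmult_le_reg_r b); rewrite ?Rmult_1_l /Rdiv ?Rmult_assoc ?Rinv_l; lra.
Qed.

Lemma pow_one_minus_le_exp (p : R) (m : nat) :
  (0 <= p <= 1)%R -> ((1 - p) ^ m <= exp (- (INR m * p)))%R.
Proof.
move=> p01; have -> : (exp (- (INR m * p)) = exp (- p) ^ m)%R.
  elim: m => [|m IHm]; first by rewrite Rmult_0_l Ropp_0 exp_0.
  by rewrite -[RHS]/(exp (- p) * exp (- p) ^ m)%R -IHm -exp_plus S_INR; congr exp; ring.
by apply: pow_incr; have := exp_ineq1_le (- p); lra.
Qed.

Lemma INR_pow4_le_exp (m : nat) : (INR (4 ^ m) <= exp (2 * INR m))%R.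
Proof.
have e2 : (4 <= exp 2)%R.
  have -> : (2 = 1 + 1)%R by lra.
  by rewrite exp_plus; have := exp_ineq1_le 1; nra.
elim: m => [|m IHm]; first by rewrite expn0 Rmult_0_r exp_0 /=; lra.
rewrite expnS mult_INR (S_INR m).
have -> : (2 * (INR m + 1) = 2 + 2 * INR m)%R by ring.
rewrite exp_plus; apply: Rmult_le_compat => //; try exact: pos_INR.
by rewrite /=; lra.
Qed.

Lemma exp_opp_le_inv (z : R) : (0 < z)%R -> (exp (- z) <= / z)%R.
Proof.
move=> z0; rewrite exp_Ropp; apply: Rinv_le_contravar => //.
by have := exp_ineq1_le z; lra.
Qed.

(* [n / (16 D)] vertices lie in [t] pieces, so the exponent [eps (t k)^2 / n]
   is linear in [n] independently of [k], while [2 m <= 2 n / k]. *)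
Lemma failure_bound (eps delta : R) (D k n m t : nat) :
    (0 < eps)%R -> (0 < delta)%R ->
    (0 < D)%nat -> (1024 * INR D ^ 2 <= eps * INR k)%R ->
    (0 < k)%nat -> (m * k <= n)%nat -> (n <= 16 * D * (t * k))%nat ->
    (eps <= INR n)%R -> (512 * INR D ^ 2 <= eps * delta * INR n)%R ->
  (INR (4 ^ m) * (1 - eps / INR n) ^ (t * k * (t * k)) <= delta)%R.
Proof.
move=> eps0 delta0 D0 lek k0 lemk len leepsn ledelta.
have RD0 : (0 < INR D)%R by apply: lt_0_INR; apply/ssrnat.ltP.
have Rk0 : (0 < INR k)%R by apply: lt_0_INR; apply/ssrnat.ltP.
have Rn0 : (0 < INR n)%R by lra.
have p01 := Rdiv_unit_interval eps0 leepsn.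
(* With this [z] the number of pairs of families is at most [exp z] and each fails with probability
   at most [exp (- 2 z)]. The product [exp (- z)] is at most [/ z], hence at most [delta]. *)
pose z := (eps * INR n / (512 * INR D ^ 2))%R.
have D20 : (0 < 512 * INR D ^ 2)%R by have := pow_lt _ 2 RD0; lra.
have def_z : (z * (512 * INR D ^ 2) = eps * INR n)%R by rewrite /z; field; lra.
have z_delta : (1 <= z * delta)%R.
  by apply: (Rmult_le_reg_r _ _ _ D20); nra.
have z0 : (0 < z)%R by nra.
have m_le : (2 * INR m <= z)%R.
  have : (INR m * INR k <= INR n)%R by rewrite -mult_INR; apply: le_INR; apply/ssrnat.leP.
  have := pos_INR m; move=> m0 mk; apply: (Rmult_le_reg_r _ _ _ D20).
  rewrite def_z; apply: (Rle_trans _ (INR m * (eps * INR k))); nra.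
have y_ge : (2 * z <= INR (t * k * (t * k)) * (eps / INR n))%R.
  have : (INR n <= 16 * INR D * INR (t * k))%R.
    have -> : (16 = INR 16)%R by rewrite INR_IZR_INZ.
    by rewrite -!mult_INR; apply: le_INR; apply/ssrnat.leP.
  rewrite (mult_INR (t * k)); move: (INR (t * k)) => s les.
  apply: (Rmult_le_reg_r _ _ _ D20); rewrite Rmult_assoc def_z.
  apply: (Rmult_le_reg_r _ _ _ Rn0).
  have -> : (s * s * (eps / INR n) * (512 * INR D ^ 2) * INR n =
             2 * eps * (16 * INR D * s) ^ 2)%R by field; lra.
  have : (INR n ^ 2 <= (16 * INR D * s) ^ 2)%R by apply: pow_incr; lra.
  nra.
apply: (Rle_trans _ (exp (2 * INR m) * exp (- (INR (t * k * (t * k)) * (eps / INR n))))).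
  apply: Rmult_le_compat; [exact: pos_INR | by apply: pow_le; lra | |].
    exact: INR_pow4_le_exp.
  exact: pow_one_minus_le_exp.
rewrite -exp_plus; apply: (Rle_trans _ (exp (- z))).
  by apply: Rnot_lt_le => /exp_lt_inv; lra.
apply: Rle_trans (exp_opp_le_inv z0) _.
apply: (Rmult_le_reg_l z) => //; rewrite Rinv_r; lra.
Qed.

Theorem theorem6 :
  forall eps Delta : R, (0 < eps)%R -> (0 < Delta)%R ->
  exists c : R, (0 < c)%R /\
    forall delta : R, (0 < delta)%R ->
    exists N : nat, forall n : nat, (N <= n)%N ->
      forall G : rel 'I_n,
        simple_graph G -> connected_graph G -> max_degree_le G Delta ->
        (1 - delta <=
           gnp_prob (eps / INR n)
             (fun S => has_path_of_length_ge (union_graph G S) (c * INR n)))%R.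
Proof.
move=> eps Delta eps0 Delta0.
have [D leD] := INR_unbounded Delta.
have RD0 : (0 < INR D)%R by lra.
have D0 : (0 < D)%nat by apply/ssrnat.ltP/INR_lt.
(* This [k] makes [2 * n / k] at most the [z] of [failure_bound], and it depends on neither [delta]
   nor [n]. *)
have [k ltk] := INR_unbounded (1024 * INR D ^ 2 / eps).
have lek : (1024 * INR D ^ 2 <= eps * INR k)%R.
  have : (eps * (1024 * INR D ^ 2 / eps) = 1024 * INR D ^ 2)%R by field; lra.
  nra.
have Rk0 : (0 < INR k)%R by have := pow_lt _ 2 RD0; nra.
have k0 : (0 < k)%nat by apply/ssrnat.ltP/INR_lt.
have RDk : (0 < 4 * INR D * INR k)%R by nra.
(* There will be at least [n / (2 D k)] pieces, and at most half of them are lost to the term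
   [2 * t]. *)
exists (/ (4 * INR D * INR k))%R; split; first exact: Rinv_0_lt_compat.
move=> delta delta0.
have [N1 ltN1] := INR_unbounded eps.
have [N2 ltN2] := INR_unbounded (512 * INR D ^ 2 / (eps * delta)).
(* The first term ensures at least four pieces, [N1] makes [eps / n] a probability, and [N2] brings
   the failure below [delta]. *)
exists (8 * D * k + N1 + N2)%nat => n len G [symG _] cG degG.
have leN1 : (INR N1 <= INR n)%R by apply: le_INR; apply/ssrnat.leP; lia.
have leepsn : (eps <= INR n)%R by lra.
have leN2 : (INR N2 <= INR n)%R by apply: le_INR; apply/ssrnat.leP; lia.
have degGD x : (#|[set y | G x y]| <= D)%nat.
  by apply/ssrnat.leP/INR_le; have := degG x; rewrite /degree; lra.
have cT : connected_set G [set: 'I_n].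
  move=> x y _ _; apply: connect_sub (cG x y) => a b Gab.
  by apply: connect1; rewrite /induced !inE.
have [P [tP PP]] := connected_pieces symG degGD D0 k0 cT.
rewrite cardsT card_ord => leP.
have lePn : (#|P| * k <= n)%nat.
  rewrite -[n in (_ <= n)%nat]card_ord; apply: leq_trans (max_card (mem (cover P))).
  by apply: card_cover_ge => // A /PP[].
pose t := (#|P| %/ 4)%nat.
(* Four pieces make [t] positive, so rounding down costs at most a factor 2: [#|P| <= 8 * t]. With
   [leDk], where the remainder [k] is absorbed by doubling, this gives [n <= 16 * D * (t * k)]. *)
have leP4 : (4 <= #|P|)%nat by nia.
have let8 : (#|P| <= 8 * t)%nat by rewrite /t; lia.
have let4 : (4 * t <= #|P|)%nat by rewrite /t; lia.
have leDk : (n <= 2 * D * k * #|P|)%nat by nia.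
have p01 := Rdiv_unit_interval eps0 leepsn.
have PP' : {in P, forall A : {set 'I_n}, connected_set G A /\ (k <= #|A|)%nat}.
  by move=> A /PP[].
have le2t : (2 * t <= #|P|)%nat by lia.
have failP : (INR (4 ^ #|P|) * (1 - eps / INR n) ^ (t * k * (t * k)) <= delta)%R.
  apply: (failure_bound eps0 delta0 D0 lek k0 lePn); [by nia | done |].
  have ed0 : (0 < eps * delta)%R by nra.
  have : (eps * delta * (512 * INR D ^ 2 / (eps * delta)) = 512 * INR D ^ 2)%R.
    by field; lra.
  nra.
have leRP : (INR n <= 2 * INR D * INR k * INR #|P|)%R.
  have -> : (2 = INR 2)%R by [].
  by rewrite -!mult_INR; apply: le_INR; apply/ssrnat.leP.
have let4R : (2 * INR (2 * t) <= INR #|P|)%R.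
  have -> : (2 = INR 2)%R by [].
  by rewrite -mult_INR; apply: le_INR; apply/ssrnat.leP; lia.
have leL : (/ (4 * INR D * INR k) * INR n + INR (2 * t) <= INR #|P|)%R.
  have : (4 * INR D * INR k * (/ (4 * INR D * INR k) * INR n) = INR n)%R.
    by field; lra.
  nra.
apply: Rle_trans (gnp_prob_long_path symG tP PP' k0 le2t leL p01).
by apply: Rplus_le_compat_l; apply: Ropp_le_contravar.
Qed.
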